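(* Let $\Pi=\{p_1,\dots,p_n\}$ be miners with $m_{p_1}>m_{p_2}>\dots>m_{p_n}$, let $C$ be a finite set of coins, $F:C\to\mathbb{R}_+$ a reward function, and $s_0,s_f$ two stable configurations of the game $G_{\Pi,C,F}$. Then every stage $i>1$ of the dynamic reward design algorithm (described in the context) from $s_0$ to $s_f$ completes in a finite number of loop iterations.
   Context: Games. Each miner $p$ has mining power $m_p\in\mathbb{R}_+$ ($\mathbb{R}_+$ denotes the positive reals). A reward function is a map $C\to\mathbb{R}_+$. For a reward function $F$, the game $G_{\Pi,C,F}$ is as follows. A configuration assigns to each miner a coin; $S=C^n$ is the set of configurations, $s.p$ is the coin of $p$ in $s$. $P_c(s)=\{p: s.p=c\}$, $M_c(s)=\sum_{p\in P_c(s)}m_p$, and the revenue per unit of coin $c$ is $RPU_c(s)=F(c)/M_c(s)$. The payoff of $p$ is $u_p(s)=m_p F(s.p)/M_{s.p}(s)$. $(s_{-p},c)$ is $s$ with $p$'s coin replaced by $c$; the move of $p$ to $c$ is a better response step in $s$ if $u_p(s)<u_p((s_{-p},c))$. A configuration is stable if no miner has a better response step in it. A better response learning from $s$ is a sequence of configurations resulting from a sequence of better response steps (of arbitrary miners, in arbitrary order) starting from $s$, which is either infinite or ends with a stable configuration; if finite, it converges to its final configuration. Intermediate configurations. For $1\le i\le n$, $s_i$ is the configuration with $s_i.p_k=s_f.p_k$ for $1\le k\le i$ and $s_i.p_k=s_f.p_i$ for $i<k\le n$ (so $s_n=s_f$). For $i>1$, $$T_i=\{s\in S:\ (\forall k,\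 1\le k\le i-1:\ s.p_k=s_f.p_k)\ \wedge\ (\forall k,\ i\le k\le n:\ s.p_k\in\{s_f.p_i,s_f.p_{i-1}\})\}.$$ For $s\in T_i\setminus\{s_i\}$ let $m_i(s)=\min\{j:\ \forall l,\ j<l\le n:\ s.p_l=s_f.p_i\}$ and $a_i(s)=m_i(s)-1$. Reward design. For $s\in S$ let $R(s)=\max\{RPU_c(s): c\in C\}$, the RPUs being those of $G_{\Pi,C,F}$. For $i>1$, $s\in T_i$ and $c\in C$, the reward design function $H_i$ of stage $i$ is $$H_i(s)(c)=\begin{cases}R(s)\cdot(M_c(s)+m_{p_{a_i(s)}}) & \text{for } c=s_f.p_i,\\ R(s)\cdot M_c(s) & \text{otherwise,}\end{cases}$$ and for $i=1$, $s\in S$, $c\in C$, $$H_1(s)(c)=\begin{cases}\max\{F(c'): c'\in C\}\cdot\sum_{p\in\Pi}m_p & \text{for } c=s_f.p_1,\\ F(c) & \text{otherwise.}\end{cases}$$ $G_{\Pi,C,H_i(s)}$ is the game with the fixed reward function $H_i(s)$ in place of $F$. Algorithm. Set $s\leftarrow s_0$. For $i=1,\dots,n$ perform stage $i$: repeat the loop iteration ''allow better response learning in $G_{\Pi,C,H_i(s)}$, starting from $s$, to converge to some stable configuration $s'$ of that game; set $s\leftarrow s'$'' until $s=s_i$. Stage $i$ completes when $s=s_i$. *)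

(* Defs.v *)
From HB Require Import structures.
From mathcomp Require Import all_boot all_order all_algebra.

Set Implicit Arguments.
Unset Strict Implicit.
Unset Printing Implicit Defensive.

Import Order.TTheory GRing.Theory Num.Theory.
Local Open Scope ring_scope.

(* The miners p_1, ..., p_n are the elements 0, ..., n.-1 of                    *)
(* 'I_n (p_k is the ordinal k.-1), and stages are indexed by 'I_n in the same   *)
(* way: the stage usually written i is the ordinal i.-1, so that "i > 1" reads  *)
(* (0 < i)%N. Coins form an arbitrary finite type C.                            *)

Definition config (n : nat) (C : finType) := {ffun 'I_n -> C}.

Section Game.

Variables (R : realFieldType) (n : nat) (C : finType).
Variable m : 'I_n -> R.
Variable F : C -> R.
Implicit Types (s : config n C) (c : C) (p : 'I_n).

Definition mass s c : R := \sum_(p | s p == c) m p.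

(* On a coin without miners this is F c / 0 = 0.                                *)
Definition rpu s c : R := F c / mass s c.

Definition payoff s p : R := m p * F (s p) / mass s (s p).

Definition move s p c : config n C := [ffun q => if q == p then c else s q].

Definition better_response s p c : bool := payoff s p < payoff (move s p c) p.

Definition br_step s s' : bool :=
  [exists p, exists c, (s' == move s p c) && better_response s p c].

Definition stable s : bool := [forall p, forall c, ~~ better_response s p c].

(* The two kinds of better response learning from s: t lists the configurations *)
(* visited after s by a finite one; sigma enumerates an infinite one, s included. *)
Definition finite_learning s (t : seq (config n C)) : bool :=
  path br_step s t && stable (last s t).

Definition infinite_learning s (sigma : nat -> config n C) : Prop :=
  sigma 0%N = s /\ forall k, br_step (sigma k) (sigma k.+1).

Definition may_converge_to s s' : Prop :=
  exists2 t, finite_learning s t & last s t = s'.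

Definition learning_converges s : Prop :=
  forall sigma, ~ infinite_learning s sigma.

End Game.

Section RewardDesign.

Variables (R : realFieldType) (n : nat) (C : finType).
Variable m : 'I_n -> R.
Variable F : C -> R.
Variable sf : config n C.
Implicit Types (i j k l : 'I_n) (s : config n C) (c : C).

Definition prev_miner i : 'I_n := Ordinal (leq_ltn_trans (leq_pred i) (ltn_ord i)).

Lemma last_subproof i : (n.-1 < n)%N.
Proof. by rewrite prednK // (leq_ltn_trans _ (ltn_ord i)). Qed.

Definition last_miner i : 'I_n := Ordinal (last_subproof i).

Definition intermediate i : config n C :=
  [ffun k : 'I_n => if (k <= i)%N then sf k else sf i].

Definition stage_set i : {set config n C} :=
  [set s : config n C |
    [forall k : 'I_n, (k < i)%N ==> (s k == sf k)] &&
    [forall k : 'I_n, (i <= k)%N ==> ((s k == sf i) || (s k == sf (prev_miner i)))]].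

(* The condition holds vacuously at the last miner, so this is a true minimum.  *)
(* Like anchor, it is only meaningful for s in stage_set i minus intermediate i;*)
(* there its value is at least i, so that prev_miner is then a true predecessor.     *)
Definition min_index i s : 'I_n :=
  [arg min_(j < last_miner i | [forall l : 'I_n, (j < l)%N ==> (s l == sf i)])
     (j : nat)].

Definition anchor i s : 'I_n := prev_miner (min_index i s).

(* By the convention x / 0 = 0, coins without miners do not contribute to this  *)
(* maximum. All RPUs are nonnegative, so the default value 0 is harmless.       *)
Definition max_rpu s : R := \big[Num.max/0]_(c : C) rpu m F s c.

Definition max_reward : R := \big[Num.max/0]_(c : C) F c.

(* In a stage after the first one, coins without miners, other than sf i, get   *)
(* reward 0.                                                                    *)
Definition design i s : C -> R := fun c =>
  if i == 0%N :> nat then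
    if c == sf i then max_reward * \sum_p m p else F c
  else
    if c == sf i then max_rpu s * (mass m s c + m (anchor i s))
    else max_rpu s * mass m s c.

Definition loop_iteration i s s' : Prop :=
  may_converge_to m (design i s) s s'.

(* stage_completes i s: however the better response learnings unfold, stage i,  *)
(* when it is at configuration s, reaches intermediate i after finitely many    *)
(* loop iterations. Being inductive, the predicate excludes infinite            *)
(* executions. It also requires that every iteration is well defined (s lies in *)
(* the domain stage_set i of the reward design function when the stage is not   *)
(* the first one) and that the learning allowed in it always converges.         *)
Inductive stage_completes i : config n C -> Prop :=
| stage_done : stage_completes i (intermediate i)
| stage_loop s :
    s <> intermediate i ->
    ((0 < i)%N -> s \in stage_set i) ->
    learning_converges m (design i s) s ->
    (forall s', loop_iteration i s s' -> stage_completes i s') ->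
    stage_completes i s.

(* Stage i starts where the preceding stage completed, i.e. at its intermediate *)
(* configuration; the first stage starts at s0.                                 *)
Definition stage_start (s0 : config n C) i : config n C :=
  if i == 0%N :> nat then s0 else intermediate (prev_miner i).

End RewardDesign.

(* Main.v *)
(* Write d = sf i and c' = sf (i - 1), and let s be a configuration of stage i,
   with j the last miner of s on c' and a = j - 1. In the designed game every
   nonempty coin has the same RPU r in s, except that the reward of d leaves room
   for an additional mass x < m_a. If x denotes the mass gained by d since the
   start of the learning, then 0 <= x < m_a is invariant, every step makes x
   positive, and only miners lighter than a, i.e. with index at least j, can move,
   always between c' and d. For such moves the smaller of the two RPUs increases,
   so the learning converges. Since x > 0 in the final configuration, j ends up on
   d, while the miners before j did not move: the set of miners on d increases
   lexicographically from one loop iteration to the next. *)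
Require Import Defs.
From HB Require Import structures.
From mathcomp Require Import all_boot all_order all_algebra.
From mathcomp Require Import lra.
Import Order.TTheory GRing.Theory Num.Theory.
Local Open Scope ring_scope.

Set Implicit Arguments.
Unset Strict Implicit.
Unset Printing Implicit Defensive.

(** Pigeonhole: [u] would separate the first [#|T|.+1] terms of the sequence. *)
Lemma no_increasing_sequence (R : realFieldType) (T : finType) (u : T -> R)
    (sigma : nat -> T) :
  ~ (forall k, u (sigma k) < u (sigma k.+1)).
Proof.
move=> u_incr.
have u_lt k l : (k < l)%N -> u (sigma k) < u (sigma l).
  exact: (homo_ltn (f := u \o sigma) lt_trans u_incr).
have inj : injective (fun k : 'I_#|T|.+1 => sigma k).
  move=> k l /= eq_kl; apply/val_inj => /=.
  by case: (ltngtP k l) => // /u_lt; rewrite eq_kl ltxx.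
by have := leq_card _ inj; rewrite card_ord ltnn.
Qed.

(** * Better responses in terms of masses and RPUs *)

Section Moves.

Variables (R : realFieldType) (n : nat) (C : finType).
Variables (m : 'I_n -> R) (F : C -> R).
Hypothesis m_gt0 : forall p, 0 < m p.
Implicit Types (s t : config n C) (c : C) (p : 'I_n).

Lemma mass_ge0 s c : 0 <= mass m s c.
Proof. by apply: sumr_ge0 => p _; apply: ltW. Qed.

Lemma le_mass s t c :
  (forall p, s p = c -> t p = c) -> mass m s c <= mass m t c.
Proof.
move=> sub; rewrite /mass big_mkcond [leRHS]big_mkcond /=; apply: ler_sum => p _.
case: eqP => [/sub ->|_]; first by rewrite eqxx.
by case: ifP => _ //; apply: ltW.
Qed.

Lemma mass_gt0 s p : 0 < mass m s (s p).
Proof.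
rewrite /mass (bigD1 p) //= ltr_wpDr //.
by apply: sumr_ge0 => q _; apply: ltW.
Qed.

Lemma mass_move_to s p c :
  s p != c -> mass m (move s p c) c = mass m s c + m p.
Proof.
move=> sp; rewrite /mass (bigD1 p) /= ?ffunE ?eqxx // addrC; congr (_ + _).
apply: eq_bigl => q; rewrite ffunE; case: (eqVneq q p) => [->|_] /=.
  by rewrite andbF (negbTE sp).
by rewrite andbT.
Qed.

Lemma mass_move_from s p c :
  s p != c -> mass m (move s p c) (s p) = mass m s (s p) - m p.
Proof.
move=> sp; rewrite /mass [in RHS](bigD1 p) //= [m p + _]addrC addrK.
apply: eq_bigl => q; rewrite ffunE; case: (eqVneq q p) => [->|_] /=.
  by rewrite andbF eq_sym (negbTE sp).
by rewrite andbT.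
Qed.

Lemma better_response_neq s p c : better_response m F s p c -> s p != c.
Proof.
apply: contraTneq => <-; rewrite /better_response.
suff -> : move s p (s p) = s by rewrite ltxx.
by apply/ffunP => q; rewrite ffunE; case: eqP => [->|].
Qed.

Lemma better_response_rpu s p c :
  better_response m F s p c = (rpu m F s (s p) < rpu m F (move s p c) c).
Proof.
rewrite /better_response /payoff /rpu !ffunE eqxx -!mulrA.
by rewrite (ltr_pM2l (m_gt0 p)).
Qed.

Lemma better_responseE s p c : s p != c ->
  better_response m F s p c =
  (F (s p) * (mass m s c + m p) < F c * mass m s (s p)).
Proof.
move=> sp; rewrite better_response_rpu /rpu mass_move_to //.
have M1 := mass_gt0 s p.
have M2 : 0 < mass m s c + m p by rewrite ltr_wpDl ?mass_ge0.
by rewrite ltr_pdivrMr // mulrAC ltr_pdivlMr.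
Qed.

(** After the move both RPUs exceed the old RPU of the coin left: that coin has lost mass, and the
    other is where the mover gains. The last hypothesis keeps the coin left from becoming empty,
    when its RPU would be 0 by convention. *)
Lemma min_rpu_lt s p c :
  better_response m F s p c -> 0 < F (s p) ->
  0 < mass m (move s p c) (s p) ->
  Num.min (rpu m F s (s p)) (rpu m F s c) <
  Num.min (rpu m F (move s p c) (s p)) (rpu m F (move s p c) c).
Proof.
move=> br F0 M0; have sp := better_response_neq br.
rewrite better_response_rpu in br.
rewrite gt_min lt_min br andbT; apply/orP; left.
rewrite /rpu ltr_pM2l // ltf_pV2 ?posrE ?mass_gt0 //.
by rewrite mass_move_from // gtrBl.
Qed.

End Moves.

(** * A lexicographic order on configurations *)

Section Lexicographic.

Variables (n : nat) (C : finType) (d : C).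
Implicit Types s t u : config n C.

Definition lex_lt s t : bool :=
  [exists j : 'I_n,
    [&& [forall k : 'I_n, (k < j)%N ==> (s k == t k)], s j != d & t j == d]].

Lemma lex_ltP s t :
  reflect (exists j : 'I_n,
             [/\ forall k : 'I_n, (k < j)%N -> s k = t k, s j <> d & t j = d])
          (lex_lt s t).
Proof.
apply: (iffP existsP) => -[j].
  case/and3P=> /forallP eq_st /eqP sj /eqP tj; exists j; split=> // k lt_kj.
  exact/eqP/(implyP (eq_st k)).
case=> eq_st sj tj; exists j; apply/and3P; split; try exact/eqP.
by apply/forallP => k; apply/implyP => lt_kj; rewrite eq_st.
Qed.

Lemma lex_lt_irr s : lex_lt s s = false.
Proof. by apply/lex_ltP => -[j []]. Qed.

Lemma lex_lt_trans s t u : lex_lt s t -> lex_lt t u -> lex_lt s u.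
Proof.
move=> /lex_ltP[j [eq_st sj tj]] /lex_ltP[k [eq_tu tk uk]]; apply/lex_ltP.
case: (ltngtP j k) => [lt_jk|lt_kj|/val_inj eq_jk]; last by rewrite -eq_jk in tk.
  exists j; split=> // [l lt_lj|]; last by rewrite -eq_tu.
  by rewrite eq_st // eq_tu // (ltn_trans lt_lj).
exists k; split=> // [l lt_lk|]; last by rewrite eq_st.
by rewrite eq_st ?eq_tu // (ltn_trans lt_lk).
Qed.

(** Turns the order into a natural number that decreases along it; [t] itself witnesses
    strictness. *)
Lemma card_lex_lt s t :
  lex_lt s t -> (#|[set u | lex_lt t u]| < #|[set u | lex_lt s u]|)%N.
Proof.
move=> lt_st; apply/proper_card/properP; split.
  by apply/subsetP => u; rewrite !inE; apply: lex_lt_trans.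
by exists t; rewrite inE // lex_lt_irr.
Qed.

End Lexicographic.

(** * Configurations of a stage *)

Section Stage.

Variables (R : realFieldType) (n : nat) (C : finType).
Variables (m : 'I_n -> R) (F : C -> R) (sf : config n C).
Hypothesis m_gt0 : forall p, 0 < m p.
Hypothesis m_decr : forall p q : 'I_n, (p < q)%N -> m q < m p.
Hypothesis F_gt0 : forall c, 0 < F c.
Variable i : 'I_n.
Hypothesis i_gt0 : (0 < i)%N.
Implicit Types (s t : config n C) (c : C) (p : 'I_n).

Local Notation d := (sf i).
Local Notation c' := (sf (prev_miner i)).

Lemma stage_setP s :
  reflect ((forall k : 'I_n, (k < i)%N -> s k = sf k) /\
           (forall k : 'I_n, (i <= k)%N -> s k = d \/ s k = c'))
          (s \in stage_set sf i).
Proof.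
rewrite inE; apply: (iffP andP) => -[H1 H2]; split.
- by move=> k lt_ki; apply/eqP/(implyP (forallP H1 k)).
- by move=> k le_ik; have /orP[] := implyP (forallP H2 k) le_ik;
    move/eqP; [left | right].
- by apply/forallP => k; apply/implyP => /H1 ->.
- by apply/forallP => k; apply/implyP => /H2 [->|->]; rewrite eqxx ?orbT.
Qed.

Lemma intermediate_prev_stage_set :
  intermediate sf (prev_miner i) \in stage_set sf i.
Proof.
apply/stage_setP; split=> k; rewrite ffunE /=.
  by rewrite -[(k <= _)%N]ltnS prednK // => ->.
by rewrite -[(k <= _)%N]ltnS prednK // ltnNge => ->; right.
Qed.

(** * One loop iteration from an unfinished configuration *)

Section Iteration.

Variable s : config n C.
Hypothesis sT : s \in stage_set sf i.
Hypothesis s_neq : s <> intermediate sf i.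

Let j := min_index sf i s.
Let a := anchor sf i s.

Lemma intermediate_of_on_target :
  (forall k : 'I_n, (i <= k)%N -> s k = d) -> s = intermediate sf i.
Proof.
case/stage_setP: sT => s_lt _ s_ge.
apply/ffunP => k; rewrite ffunE; case: ifP => [|/negbT].
  rewrite leq_eqVlt => /orP[/eqP/val_inj ->|/s_lt //]; exact: s_ge.
by rewrite -ltnNge => /ltnW/s_ge.
Qed.

(** If the two coins coincided, the stage set would contain only the intermediate configuration. *)
Lemma coins_neq : c' <> d.
Proof.
case/stage_setP: sT => _ s_ge eq_cd; apply/s_neq/intermediate_of_on_target.
by move=> k /s_ge; rewrite eq_cd => -[].
Qed.

Lemma s_prev : s (prev_miner i) = c'.
Proof. by case/stage_setP: sT => + _; apply; rewrite /= ltn_predL. Qed.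

Lemma min_index_spec :
  [/\ (i <= j)%N, s j = c' & forall k : 'I_n, (j < k)%N -> s k = d].
Proof.
case/stage_setP: (sT) => s_lt s_ge.
rewrite /j /min_index; case: arg_minnP => [|k /forallP Pk k_min].
  apply/forallP => l; apply/implyP; rewrite /= ltnNge -[(l <= _)%N]ltnS.
  by rewrite prednK ?ltn_ord // (leq_ltn_trans _ (ltn_ord l)).
have {}Pk (l : 'I_n) : (k < l)%N -> s l = d by move=> /(implyP (Pk l))/eqP.
have sk : s k <> d.
  (* Minimality is contradicted by the predecessor of [k], but [prev_miner] fixes 0. For [k] = 0 all
     miners would be on [d], including [prev_miner i], which is on [c']. *)
  move=> sk; have [k0|k_gt0] := posnP k.
    apply: coins_neq; rewrite -s_prev.
    by have [/Pk|] := ltnP k (prev_miner i) => //;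
      rewrite k0 leqn0 -[0%N]k0 => /eqP/val_inj ->.
  have /k_min : [forall l : 'I_n, (prev_miner k < l)%N ==> (s l == d)].
    apply/forallP => l; apply/implyP; rewrite /= prednK // leq_eqVlt.
    by case/orP=> [/eqP/val_inj <-|/Pk ->] //; apply/eqP.
  by rewrite /= leqNgt ltn_predL k_gt0.
have le_ik : (i <= k)%N.
  rewrite leqNgt; apply/negP => lt_ki; apply/s_neq/intermediate_of_on_target.
  by move=> l le_il; apply: Pk; apply: leq_trans le_il.
by split=> //; case: (s_ge k le_ik).
Qed.

Lemma anchor_gt : m j < m a.
Proof.
case: min_index_spec => le_ij _ _; apply: m_decr.
by rewrite /= ltn_predL (leq_trans i_gt0).
Qed.

Lemma lighter_than_anchor p : m p < m a -> (j <= p)%N.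
Proof.
case: min_index_spec => le_ij _ _; apply: contraTT; rewrite -ltnNge -leNgt.
have j_gt0 : (0 < j)%N := leq_trans i_gt0 le_ij.
rewrite -{1}(prednK j_gt0) ltnS leq_eqVlt => /orP[/eqP eq_pa|lt_pa].
  by have -> : p = a by apply: val_inj.
exact/ltW/m_decr.
Qed.

(** * The designed rewards *)

Local Notation r := (max_rpu m F s).
Local Notation G := (design m F sf i s).

Lemma design_target : G d = r * (mass m s d + m a).
Proof. by rewrite /design gtn_eqF // eqxx. Qed.

Lemma design_other c : c != d -> G c = r * mass m s c.
Proof. by move=> /negbTE c_neq; rewrite /design gtn_eqF // c_neq. Qed.

Lemma max_rpu_gt0 : 0 < r.
Proof.
apply: (@lt_le_trans _ _ (rpu m F s (s i))); first by rewrite divr_gt0 ?mass_gt0.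
exact: le_bigmax.
Qed.

(** An invariant of the learning from [s], not reachability by steps; the last two clauses bound the
    mass gained by [d]. *)
Definition reachable t :=
  [/\ forall k : 'I_n, (k < j)%N -> t k = s k,
      forall k : 'I_n, (j <= k)%N -> t k = d \/ t k = c',
      mass m s d <= mass m t d & mass m t d < mass m s d + m a].

Lemma reachable_refl : reachable s.
Proof.
case: min_index_spec => le_ij _ _; case/stage_setP: sT => _ s_ge.
split=> // [k le_jk|]; last by rewrite ltrDl.
exact/s_ge/(leq_trans le_ij).
Qed.

Lemma reachable_prev t : reachable t -> t (prev_miner i) = c'.
Proof.
case: min_index_spec => le_ij _ _ [t_lt _ _ _].
by rewrite t_lt ?s_prev // (leq_trans _ le_ij) //= ltn_predL.
Qed.

Lemma reachable_stage_set t : reachable t -> t \in stage_set sf i.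
Proof.
case: min_index_spec => le_ij _ _ [t_lt t_ge _ _].
case/stage_setP: sT => s_lt s_ge; apply/stage_setP; split=> k lt_k.
  by rewrite t_lt ?s_lt // (leq_trans lt_k).
by have [/t_lt ->|/t_ge//] := ltnP k j; apply: s_ge.
Qed.

Lemma reachable_mass_other t c :
  reachable t -> c != d -> c != c' -> mass m t c = mass m s c.
Proof.
case: reachable_refl => _ s_ge _ _ [t_lt t_ge _ _] /negbTE cd /negbTE cc'.
apply: eq_bigl => k; have [/t_lt -> //|le_jk] := ltnP k j.
by case: (t_ge k le_jk) => ->; case: (s_ge k le_jk) => ->;
  rewrite !(eq_sym _ c) ?cd ?cc'.
Qed.

(** The miners on one of the two coins are the same in [t] as in [s]: those before [j] are fixed,
    the others are always on [d] or [c']. *)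
Lemma reachable_mass_sum t :
  reachable t -> mass m t d + mass m t c' = mass m s d + mass m s c'.
Proof.
have pairE u : mass m u d + mass m u c' = \sum_(p | (u p == d) || (u p == c')) m p.
  rewrite [RHS](bigID (fun p => u p == d)) /=.
  congr (_ + _); apply: eq_bigl => p; case: (eqVneq (u p) d) => [->|_] //=.
  - by rewrite andbF.
  - by apply/negbTE; rewrite eq_sym; apply/eqP/coins_neq.
  - by rewrite andbT.
case: reachable_refl => _ s_ge _ _ [t_lt t_ge _ _]; rewrite !pairE.
apply: eq_bigl => k; have [/t_lt -> //|le_jk] := ltnP k j.
by case: (t_ge k le_jk) => ->; case: (s_ge k le_jk) => ->; rewrite !eqxx ?orbT.
Qed.

Lemma reachable_mass_le t c : reachable t -> c != d -> mass m t c <= mass m s c.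
Proof.
move=> t_r c_neq; have [->|c_neq'] := eqVneq c c'.
  have := reachable_mass_sum t_r; case: t_r => _ _; lra.
by rewrite reachable_mass_other.
Qed.

(** In [t] every occupied coin has RPU at least [r]: coins other than [d] have not gained mass, and
    [d] has gained less than [m a]. The RPU of [c] must therefore exceed [r] even after [p] has
    joined, so [c] needs room for more than [m p]. This room is at most [m a] on [d], less than
    [m a] on [c'], and zero elsewhere; hence [p] is lighter than the anchor. *)
Lemma better_response_reachable t p c :
  reachable t -> better_response m G t p c ->
  (j <= p)%N /\
  (t p = c' /\ c = d /\ mass m t d + m p < mass m s d + m a \/
   t p = d /\ c = c' /\ mass m s d < mass m t d - m p).
Proof.
move=> t_r br; have tp_neq := better_response_neq br.
move: br; rewrite better_responseE //.
have M_gt0 := mass_gt0 m_gt0 t p; have r_gt0 := max_rpu_gt0.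
have [t_lt t_ge le_x lt_x] := t_r.
have [c_eq|c_neq] := eqVneq c d.
  rewrite c_eq in tp_neq *.
  rewrite design_target design_other // -!mulrA (ltr_pM2l r_gt0) => br.
  have lt_m : mass m t d + m p < mass m s d + m a.
    rewrite -(ltr_pM2r M_gt0); apply: le_lt_trans br; rewrite mulrC.
    apply: ler_wpM2r; last exact: reachable_mass_le.
    by rewrite addr_ge0 ?mass_ge0 ?ltW.
  have le_jp : (j <= p)%N by apply: lighter_than_anchor; lra.
  split=> //; left; split=> //.
  by case: (t_ge p le_jp) => // tp; rewrite tp eqxx in tp_neq.
move=> br.
have lt_mass : mass m t c + m p < mass m s c.
  rewrite -(ltr_pM2r M_gt0).
  have [tp|tp_neq_d] := eqVneq (t p) d.
    move: br M_gt0; rewrite tp design_target design_other // -!mulrA (ltr_pM2l r_gt0).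
    move=> br _; apply: le_lt_trans br; rewrite mulrC ler_wpM2r ?ltW //.
    by rewrite ltr_wpDl ?mass_ge0.
  move: br; rewrite !design_other // -!mulrA (ltr_pM2l r_gt0) => br.
  apply: le_lt_trans br; rewrite mulrC ler_wpM2r ?reachable_mass_le //.
  by rewrite addr_ge0 ?mass_ge0 ?ltW.
have mp_gt0 := m_gt0 p.
have c_eq : c = c'.
  apply/eqP/negP => /negP c_neq'; move: lt_mass.
  by rewrite reachable_mass_other // gtrDl lt_gtF.
have sum := reachable_mass_sum t_r; rewrite -c_eq in sum.
have le_jp : (j <= p)%N by apply: lighter_than_anchor; lra.
split=> //; right; split; last by split=> //; lra.
by case: (t_ge p le_jp) => // tp; rewrite tp c_eq eqxx in tp_neq.
Qed.

(** * Convergence of the learning *)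

Definition min_rpu t := Num.min (rpu m G t d) (rpu m G t c').

Lemma br_step_reachable t t' :
  reachable t -> br_step m G t t' ->
  [/\ reachable t', mass m s d < mass m t' d & min_rpu t < min_rpu t'].
Proof.
move=> t_r /existsP[p /existsP[c /andP[/eqP -> br]]].
have [le_jp cases] := better_response_reachable t_r br.
have tp_neq := better_response_neq br.
have [t_lt t_ge le_x lt_x] := t_r.
have mp_gt0 := m_gt0 p.
have mass_d : mass m s d < mass m (move t p c) d /\
              mass m (move t p c) d < mass m s d + m a.
  case: cases => [[tp [c_eq lt_m]]|[tp [c_eq lt_m]]].
    by rewrite -c_eq mass_move_to // c_eq; split=> //; lra.
  by rewrite -{2 3}tp mass_move_from // tp; split=> //; lra.
have t'_r : reachable (move t p c).
  split=> [k lt_kj|k le_jk||]; try by case: mass_d => // /ltW.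
    by rewrite ffunE ifN ?t_lt //; apply: contraTneq lt_kj => ->; rewrite -leqNgt.
  rewrite ffunE; case: eqP => _; last exact: t_ge.
  by case: cases => [[_ [-> _]]|[_ [-> _]]]; [left | right].
split=> //; first by case: mass_d.
(* Both coins stay occupied, as [min_rpu_lt] requires of the coin left: [d] has gained mass, and
   miner [prev_miner i] never leaves [c']. *)
have Md : 0 < mass m (move t p c) d.
  by case: mass_d => + _; apply: le_lt_trans; apply: mass_ge0.
have Mc : 0 < mass m (move t p c) c'.
  by rewrite -(reachable_prev t'_r) mass_gt0.
have Gd : 0 < G d.
  by rewrite design_target mulr_gt0 ?max_rpu_gt0 // ltr_wpDl ?mass_ge0.
have Gc : 0 < G c'.
  rewrite design_other; last exact/eqP/coins_neq.
  by rewrite mulr_gt0 ?max_rpu_gt0 // -s_prev mass_gt0.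
have := min_rpu_lt m_gt0 br; rewrite /min_rpu.
case: cases => [[-> [c_eq _]]|[-> [c_eq _]]]; rewrite {}c_eq in Md Mc *.
  by move/(_ Gc Mc); rewrite minC [X in _ < X -> _]minC.
by move/(_ Gd Md).
Qed.

Lemma iteration_converges : learning_converges m G s.
Proof.
move=> sigma [sigma0 steps].
have sigma_r k : reachable (sigma k).
  elim: k => [|k IHk]; first by rewrite sigma0; apply: reachable_refl.
  by have [] := br_step_reachable IHk (steps k).
apply: (@no_increasing_sequence _ _ min_rpu sigma) => k.
by have [] := br_step_reachable (sigma_r k) (steps k).
Qed.

(** * Progress made by an iteration *)

Lemma not_stable : ~~ stable m G s.
Proof.
case: min_index_spec => _ sj _.
have sj_neq : s j != d by rewrite sj; apply/eqP/coins_neq.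
(* Miner [j] sees RPU [r] on [c'], and would see a larger one on [d], since the room [m a] left
   there exceeds [m j]. *)
apply/negP => /forallP/(_ j)/forallP/(_ d)/negP; apply.
rewrite better_responseE // design_target design_other //.
rewrite -!mulrA (ltr_pM2l max_rpu_gt0) mulrC.
by rewrite (ltr_pM2r (mass_gt0 m_gt0 s j)) ltrD2l anchor_gt.
Qed.

Lemma learning_reachable t l :
  reachable t -> mass m s d < mass m t d -> path (br_step m G) t l ->
  reachable (last t l) /\ mass m s d < mass m (last t l) d.
Proof.
elim: l t => //= t' l IHl t t_r _ /andP[step path_l].
by have [t'_r lt_t' _] := br_step_reachable t_r step; apply: IHl.
Qed.

Lemma iteration_progress s' :
  loop_iteration m F sf i s s' -> s' \in stage_set sf i /\ lex_lt d s s'.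
Proof.
move=> [[|t l] /andP[path_l stable_l] <-].
  (* At least one step is made, so [d] has strictly gained mass at the end. *)
  by rewrite (negbTE not_stable) in stable_l.
move: path_l => /= /andP[step path_l].
have [t_r lt_t _] := br_step_reachable reachable_refl step.
have [l_r lt_l] := learning_reachable t_r lt_t path_l.
split; first exact: reachable_stage_set.
case: min_index_spec => _ sj s_gt; have [l_lt l_ge _ _] := l_r.
apply/lex_ltP; exists j; split=> [k /l_lt ->||] //.
  by rewrite sj; apply: coins_neq.
(* If [j] ended off [d], every miner finally on [d] would have been there in [s]: those before [j]
   have not moved, and those after [j] were all on [d]. Then [d] could not have gained mass. *)
apply/eqP; apply: contraTT lt_l => lj; rewrite -leNgt; apply: le_mass => // k.
case: (ltngtP k j) => [/l_lt ->|/s_gt|/val_inj ->] //.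
by move=> lj'; rewrite lj' eqxx in lj.
Qed.

End Iteration.

(** Induction on the number of configurations lexicographically above [s], which each iteration
    decreases. *)
Lemma stage_completes_stage_set s :
  s \in stage_set sf i -> stage_completes m F sf i s.
Proof.
have [N] := ubnP #|[set u | lex_lt d s u]|.
elim: N s => // N IHN s lt_N sT.
have [->|/eqP s_neq] := eqVneq s (intermediate sf i); first exact: stage_done.
apply: stage_loop => //; first exact: iteration_converges.
move=> s' /(iteration_progress sT s_neq)[s'T lt_ss'].
by apply: IHN => //; apply: leq_trans (card_lex_lt lt_ss') _.
Qed.

End Stage.

Theorem theorem2 (R : realFieldType) (n : nat) (C : finType)
    (m : 'I_n -> R) (F : C -> R) (s0 sf : config n C)
    (m_gt0 : forall p : 'I_n, 0 < m p)
    (m_decr : forall p q : 'I_n, (p < q)%N -> m q < m p)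
    (F_gt0 : forall c : C, 0 < F c)
    (s0_stable : stable m F s0) (sf_stable : stable m F sf)
    (i : 'I_n) (i_gt0 : (0 < i)%N) :
  stage_completes m F sf i (stage_start sf s0 i).
Proof.
rewrite /stage_start gtn_eqF //; apply: stage_completes_stage_set => //.
exact: intermediate_prev_stage_set.
Qed.
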